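(* Let $n, k$ be integers with $0 \le k \le n$. Let $n=\sum_{i\ge 0} n_i 5^i$, $n-k=\sum_{i\ge 0} m_i 5^i$ and $k=\sum_{i\ge 0} k_i 5^i$ be the base-5 expansions of $n$, $n-k$ and $k$ (so $0\le n_i, m_i, k_i\le 4$ for all $i$). Then $$5 \mid \binom{n}{k}_F \iff 5 \mid \binom{n_0}{k_0}_F\binom{n_1}{k_1}_F\binom{n_2}{k_2}_F\cdots.$$
   Context: The Fibonacci sequence is $F_1=F_2=1$, $F_n=F_{n-1}+F_{n-2}$ for $n\ge 3$. The fibotorial is $n!_F = F_nF_{n-1}\cdots F_1$ for $n>0$, and $0!_F=1$. The fibonomial coefficient is $\binom{n}{k}_F=\frac{n!_F}{k!_F\,(n-k)!_F}$ for $0\le k\le n$, and $\binom{n}{k}_F=0$ otherwise; it is always an integer. In the product, all but finitely many digits are zero and $\binom{0}{0}_F=1$, so the product is finite. *)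

(* Defs.v *)
From mathcomp Require Import all_boot.

Set Implicit Arguments.
Unset Strict Implicit.
Unset Printing Implicit Defensive.

(* Extended by [fib 0 = 0], so that [fib 1 = fib 2 = 1]. *)
Fixpoint fib (n : nat) : nat :=
  match n with
  | 0 => 0
  | 1 => 1
  | (m.+1 as p).+1 => fib p + fib m
  end.

Definition fibotorial (n : nat) : nat := \prod_(1 <= i < n.+1) fib i.

(* The quotient is exact: see [fibotorial_dvd] and [fibonomialE]. *)
Definition fibonomial (n k : nat) : nat :=
  if k <= n then fibotorial n %/ (fibotorial k * fibotorial (n - k)) else 0.

Lemma fibSS n : fib n.+2 = fib n.+1 + fib n.
Proof. by []. Qed.

Lemma fib_addS m k : fib (m + k).+1 = fib m.+1 * fib k.+1 + fib m * fib k.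
Proof.
elim: m k => [|m IHm] k; first by rewrite mul1n mul0n addn0.
rewrite addSnnS IHm !fibSS mulnDr mulnDl -!addnA; congr (_ + _).
by rewrite addnC.
Qed.

Lemma fibotorial0 : fibotorial 0 = 1.
Proof. by rewrite /fibotorial big_geq. Qed.

Lemma fibotorialS n : fibotorial n.+1 = fib n.+1 * fibotorial n.
Proof. by rewrite /fibotorial big_nat_recr //= mulnC. Qed.

Lemma fibotorial_dvd m k : fibotorial k * fibotorial m %| fibotorial (m + k).
Proof.
have [s] := ubnP (m + k); elim: s m k => // s IHs [|m] [|k] lt_s;
  rewrite ?fibotorial0 ?addn0 ?add0n ?mul1n ?muln1 //.
rewrite addnS [fibotorial _.+1 in X in _ %| X]fibotorialS fib_addS mulnDl.
apply: dvdn_add.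
- rewrite [fibotorial k.+1]fibotorialS [fib m.+2 * _]mulnC -!mulnA.
  by rewrite dvdn_mul // dvdn_mull // IHs // -ltnS -addnS.
- rewrite [fibotorial m.+1]fibotorialS mulnCA -mulnA.
  by rewrite dvdn_mul // dvdn_mull // addSnnS IHs.
Qed.

Lemma fibonomialE n k : k <= n ->
  fibonomial n k * (fibotorial k * fibotorial (n - k)) = fibotorial n.
Proof.
move=> le_kn; rewrite /fibonomial le_kn divnK //.
by rewrite -{2}(subnK le_kn) fibotorial_dvd.
Qed.

(* [d] is the sequence of base-[b] digits of [n], least significant first, all
   digits of index at least [l] being zero; [d] is defined on all of [nat]. *)
Definition base_expansion (b l : nat) (d : nat -> nat) (n : nat) : Prop :=
  [/\ forall i, d i < b,
      forall i, l <= i -> d i = 0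
    & n = \sum_(i < l) d i * b ^ i].

(* Main.v *)
Require Import Defs.
From mathcomp Require Import all_boot.
From mathcomp Require Import ring zify.

(** With [v] the 5-adic valuation, [v (fib (5 n)) = 1 + v (fib n)] and 5 does
    not divide [fib n] when it does not divide [n]; hence the valuation of
    [fibotorial (5 q + r)], for [r < 5], is [q] plus that of [fibotorial q].
    For [n = 5 q + r] and [k = 5 t + s], either [s <= r], and the fibonomials at
    [(n, k)] and [(q, t)] have the same valuation, or [s > r], and the borrow in
    [n - k] makes the valuation at [(n, k)] positive while
    [fibonomial r s = 0]. This is a Lucas-type rule for divisibility by 5, to be
    applied digit by digit. *)

Lemma fib_gt0 n : 0 < n -> 0 < fib n.
Proof.
elim/ltn_ind: n => -[|[|n]] IHn // _.
by rewrite fibSS addn_gt0 IHn.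
Qed.

Lemma fibotorial_gt0 n : 0 < fibotorial n.
Proof.
elim: n => [|n IHn]; first by rewrite fibotorial0.
by rewrite fibotorialS muln_gt0 fib_gt0.
Qed.

Lemma fibonomial_gt0 n k : k <= n -> 0 < fibonomial n k.
Proof.
by move=> le_kn; have := fibotorial_gt0 n; rewrite -(fibonomialE le_kn) muln_gt0 => /andP[].
Qed.

(** Since 3 is invertible modulo 5, only the residue of the index modulo 5 matters. *)
Lemma dvd5_fib_addn5 n : (5 %| fib (n + 5)) = (5 %| fib n).
Proof.
have ->: fib (n + 5) = 5 * fib n.+1 + 3 * fib n by rewrite !addnS addn0 !fibSS; lia.
by rewrite (dvdn_addr _ (dvdn_mulr _ (dvdnn 5))) Gauss_dvdr.
Qed.

Lemma ndvd5_fib q r : 0 < r < 5 -> ~~ (5 %| fib (5 * q + r)).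
Proof.
move=> r_bounds; elim: q => [|q IHq]; first by case: r r_bounds => [|[|[|[|[|r]]]]].
have ->: 5 * q.+1 + r = 5 * q + r + 5 by lia.
by rewrite dvd5_fib_addn5.
Qed.

Lemma logn5_fib q r : 0 < r < 5 -> logn 5 (fib (5 * q + r)) = 0.
Proof. by move=> r_bounds; rewrite lognE (negPf (ndvd5_fib _ _ r_bounds)) !andbF. Qed.

(* This number is the Lucas number of index [n + 2], and it is multiplied by 3
   modulo 5 when [n] increases by 1. *)
Lemma ndvd5_lucas n : ~~ (5 %| fib n + 3 * fib n.+1).
Proof.
elim: n => // n; apply: contra => dvd5.
have: 5 %| 3 * (fib n + 3 * fib n.+1).
  have ->: 3 * (fib n + 3 * fib n.+1) = fib n.+1 + 3 * fib n.+2 + 5 * fib n.+1.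
    by rewrite fibSS; lia.
  by rewrite dvdn_add // dvdn_mulr.
by rewrite Gauss_dvdr.
Qed.

(** Iterating the addition formula exhibits one factor 5; the quartic cofactor is then shown to be
    prime to 5. *)
Lemma fib_mul5 n (z := fib n) (x := fib n.+1) :
  fib (5 * n.+1) =
  5 * x * (x ^ 4 + 3 * x ^ 3 * z + 4 * x ^ 2 * z ^ 2 + 2 * x * z ^ 3 + z ^ 4).
Proof.
have fibD m : fib (m + n.+1) = fib m.+1 * x + fib m * z by rewrite addnS fib_addS.
have fibDS m : fib (m + n.+1).+1 = fib m.+1 * (x + z) + fib m * x.
  by rewrite fib_addS fibSS.
have ->: 5 * n.+1 = n.+1 + n.+1 + n.+1 + n.+1 + n.+1 by lia.
rewrite !(fibD, fibDS) fibSS -/x -/z; ring.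
Qed.

Lemma logn5_fib_mul5 n : 0 < n -> logn 5 (fib (5 * n)) = (logn 5 (fib n)).+1.
Proof.
case: n => // n _; rewrite fib_mul5.
set x := fib n.+1; set z := fib n; set t := (X in _ * _ * X).
have nt5: ~~ (5 %| t).
  apply: contra (ndvd5_lucas n) => dvd5.
  suff: 5 %| (z + 3 * x) ^ 4 by rewrite Euclid_dvdX // => /andP[].
  (* Modulo 5 the quartic is the fourth power of a Lucas number. *)
  have ->: (z + 3 * x) ^ 4 =
      t + 5 * (2 * z ^ 3 * x + 10 * z ^ 2 * x ^ 2 + 21 * z * x ^ 3 + 16 * x ^ 4).
    by rewrite /t; ring.
  by rewrite dvdn_add // dvdn_mulr.
have t_gt0: 0 < t by case: (t) nt5.
have x_gt0: 0 < x by apply: fib_gt0.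
rewrite !lognM ?muln_gt0 ?x_gt0 // (@lognE 5 t) t_gt0 (negPf nt5) /=.
by rewrite addn0.
Qed.

Lemma logn5_fibotorial_digit q r : r < 5 ->
  logn 5 (fibotorial (5 * q + r)) = logn 5 (fibotorial (5 * q)).
Proof.
elim: r => [|r IHr] r_lt5; first by rewrite addn0.
rewrite addnS fibotorialS lognM ?fib_gt0 ?fibotorial_gt0 // -addnS.
by rewrite logn5_fib // IHr // ltnW.
Qed.

(** Only the factors of index [5 * i] with [1 <= i <= q] count, each giving one more than the
    valuation of [fib i]. *)
Lemma logn5_fibotorial q r : r < 5 ->
  logn 5 (fibotorial (5 * q + r)) = q + logn 5 (fibotorial q).
Proof.
move=> r_lt5; rewrite logn5_fibotorial_digit //.
elim: q => [|q IHq]; first by rewrite muln0.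
have qS_E: 5 * q.+1 = (5 * q + 4).+1 by lia.
rewrite qS_E fibotorialS -qS_E fibotorialS !lognM ?fib_gt0 ?fibotorial_gt0 //.
by rewrite logn5_fibotorial_digit // IHq logn5_fib_mul5 //; lia.
Qed.

Lemma logn_fibonomial p n k : k <= n ->
  logn p (fibonomial n k) + (logn p (fibotorial k) + logn p (fibotorial (n - k))) =
  logn p (fibotorial n).
Proof.
move=> le_kn; rewrite -(fibonomialE le_kn).
by rewrite !lognM ?muln_gt0 ?fibotorial_gt0 ?fibonomial_gt0.
Qed.

Lemma fibonomial_small n k : n < k -> fibonomial n k = 0.
Proof. by rewrite /fibonomial ltnNge => /negPf->. Qed.

Lemma dvd5_logn m : 0 < m -> (5 %| m) = (0 < logn 5 m).
Proof. by move=> m_gt0; rewrite logn_gt0 mem_primes m_gt0. Qed.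

Lemma ndvd5_fibonomial_digit r s : s <= r < 5 -> ~~ (5 %| fibonomial r s).
Proof.
case/andP=> le_sr r_lt5; rewrite dvd5_logn ?fibonomial_gt0 // -eqn0Ngt.
have := logn_fibonomial 5 _ _ le_sr; have := logn5_fibotorial 0 _ r_lt5.
by rewrite muln0 !add0n fibotorial0 logn1; lia.
Qed.

Lemma dvd5_fibonomial q r t s : r < 5 -> s < 5 ->
  (5 %| fibonomial (5 * q + r) (5 * t + s)) = (5 %| fibonomial r s * fibonomial q t).
Proof.
move=> r_lt5 s_lt5; rewrite Euclid_dvdM //.
have [le_sr | lt_rs] := leqP s r.
  have rs_bounds: s <= r < 5 by rewrite le_sr.
  rewrite (negPf (ndvd5_fibonomial_digit _ _ rs_bounds)) /=.
  have [le_tq | lt_qt] := leqP t q; last by rewrite !fibonomial_small //; lia.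
  have le_kn: 5 * t + s <= 5 * q + r by lia.
  have subE: 5 * q + r - (5 * t + s) = 5 * (q - t) + (r - s) by lia.
  have := logn_fibonomial 5 _ _ le_kn; have := logn_fibonomial 5 _ _ le_tq.
  rewrite subE !logn5_fibotorial //; last lia.
  rewrite !dvd5_logn ?fibonomial_gt0 // => ? ?; congr (0 < _); lia.
rewrite (fibonomial_small _ _ lt_rs) dvdn0 /=.
(* If [q <= t], then [r < s] puts the lower index above the upper one, and the coefficient is 0. *)
have [le_qt | lt_tq] := leqP q t; first by rewrite fibonomial_small ?dvdn0 //; lia.
have le_kn: 5 * t + s <= 5 * q + r by lia.
(* The borrow lowers the quotient by one, so the linear terms leave [q - t - (q - t.+1) = 1]. *)
have subE: 5 * q + r - (5 * t + s) = 5 * (q - t.+1) + (5 + r - s) by lia.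
have := logn_fibonomial 5 _ _ le_kn.
rewrite subE !logn5_fibotorial //; last lia.
(* The remaining fibotorial terms are nonnegative by comparison with the integer
   [fibonomial q.-1 t]. *)
have le_tq1: t <= q.-1 by lia.
have := logn_fibonomial 5 _ _ le_tq1.
have ->: q.-1 - t = q - t.+1 by lia.
have: logn 5 (fibotorial q.-1) <= logn 5 (fibotorial q).
  case: (q) lt_tq => // q' _.
  by rewrite fibotorialS lognM ?fib_gt0 ?fibotorial_gt0 ?leq_addl.
by rewrite dvd5_logn ?fibonomial_gt0 //; lia.
Qed.

(** Splits off the lowest digit, for the induction on the number of digits. *)
Lemma base_expansionS b l d n : base_expansion b l.+1 d n ->
  exists2 q, base_expansion b l (fun i => d i.+1) q & n = b * q + d 0.
Proof.
case=> lt_d d0 ->; exists (\sum_(i < l) d i.+1 * b ^ i).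
  by split=> // i le_li; apply: d0.
rewrite big_ord_recl muln1 addnC big_distrr /=; congr (_ + _).
by apply: eq_bigr => i _; rewrite expnS mulnCA.
Qed.

Theorem lemma3p1 (n k l : nat) (n_ m_ k_ : nat -> nat) :
  k <= n ->
  base_expansion 5 l n_ n ->
  base_expansion 5 l m_ (n - k) ->
  base_expansion 5 l k_ k ->
  5 %| fibonomial n k <-> 5 %| \prod_(i < l) fibonomial (n_ i) (k_ i).
Proof.
move=> _ n_exp _ k_exp.
suff -> : (5 %| fibonomial n k) = (5 %| \prod_(i < l) fibonomial (n_ i) (k_ i)) by [].
elim: l n_ k_ n k n_exp k_exp => [|l IHl] n_ k_ n k n_exp k_exp.
  case: n_exp k_exp => _ _ -> [_ _ ->].
  by rewrite !big_ord0 /fibonomial fibotorial0.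
have [[n_lt5 _ _] [k_lt5 _ _]] := (n_exp, k_exp).
have [[q q_exp ->] [t t_exp ->]] := (base_expansionS _ _ _ _ n_exp, base_expansionS _ _ _ _ k_exp).
rewrite dvd5_fibonomial // big_ord_recl !Euclid_dvdM //.
by congr (_ || _); apply: IHl q_exp t_exp.
Qed.
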